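(* Let $k,s,l$ be positive integers with $s\geq 1$ and $k,l\geq 2$. For every real $\epsilon>0$ there exists an integer $n_\epsilon$ such that for all $n\geq n_\epsilon$ the following holds: if $\mathcal{H}\subseteq\binom{[n]}{k}$ satisfies $\nu(\mathcal{H})\leq s$ and $$N(S_{k,l}^{k-1},\mathcal{H})\geq \left(\frac{s-1}{(k-2)!\,l!}+\epsilon\right)n^{k+l-2},$$ then $\mathcal{H}$ is the union of $s$ different trivial intersecting families.
   Context: $[n]=\{1,\dots,n\}$, $\binom{[n]}{k}$ is the family of $k$-subsets of $[n]$, and $\nu(\mathcal{H})$ is the largest number of pairwise disjoint members of $\mathcal{H}$. A family $\{A_1,\dots,A_l\}\subseteq\binom{[n]}{k}$ is a $k$-uniform sunflower with $l$ petals if there is a core $C$ contained in every $A_i$ with the sets $A_i\setminus C$ pairwise disjoint; $S_{k,l}^{k-1}$ is such a sunflower with core of size $k-1$, and $N(S_{k,l}^{k-1},\mathcal{H})$ is the number of $l$-element subfamilies of $\mathcal{H}$ forming a copy of $S_{k,l}^{k-1}$. A family is intersecting if any two members intersect, and trivial intersecting if the intersection of all its members is nonempty. ''$\mathcal{H}$ is the union of $s$ different trivial intersecting families'' means $\mathcal{H}=\bigcup_{i=1}^s\mathcal{G}_i$ where each $\mathcal{G}_i$ is a trivial intersecting family with common element $x_i$, the $x_i$ being distinct. *)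

(* Defs.v *)
From mathcomp Require Import all_boot all_order all_algebra.
From mathcomp Require Import reals.

Set Implicit Arguments.
Unset Strict Implicit.
Unset Printing Implicit Defensive.

(* The ground set [n] = {1, ..., n} is represented by 'I_n. *)

Definition ksubsets (T : finType) (k : nat) : {set {set T}} :=
  [set A : {set T} | #|A| == k].

Definition matching_number (T : finType) (H : {set {set T}}) : nat :=
  \max_(F : {set {set T}} | (F \subset H) && trivIset F) #|F|.

(* The petals A_1, ..., A_l are the members of F, so they are distinct sets. *)
Definition sunflower_with_core (T : finType) (k l : nat) (C : {set T})
    (F : {set {set T}}) : bool :=
  [&& F \subset ksubsets T k, #|F| == l, [forall A in F, C \subset A] &
      [forall A in F, forall B in F,
         (A != B) ==> [disjoint A :\: C & B :\: C]]].

(* F is a copy of S_{k,l}^c. *)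
Definition is_sunflower (T : finType) (k l c : nat) (F : {set {set T}}) : bool :=
  [exists C : {set T}, (#|C| == c) && sunflower_with_core k l C F].

(* N(S_{k,l}^c, H) *)
Definition num_sunflowers (T : finType) (k l c : nat) (H : {set {set T}}) : nat :=
  #|[set F : {set {set T}} | (F \subset H) && is_sunflower k l c F]|.

Definition intersecting (T : finType) (G : {set {set T}}) : Prop :=
  forall A B : {set T}, A \in G -> B \in G -> A :&: B != set0.

(* For G = set0 the intersection of all the members is the whole ground set. *)
Definition trivial_intersecting (T : finType) (G : {set {set T}}) : Prop :=
  intersecting G /\ \bigcap_(A in G) A != set0.

Definition union_of_trivial_intersecting (T : finType) (s : nat)
    (H : {set {set T}}) : Prop :=
  exists (G : 'I_s -> {set {set T}}) (x : 'I_s -> T),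
    [/\ injective x,
        forall i, trivial_intersecting (G i),
        forall i, x i \in \bigcap_(A in G i) A &
        H = \bigcup_(i < s) G i].

(* Main.v *)
(* Call a vertex heavy if its degree exceeds a suitable constant multiple of
   n^(k-2). Edges through heavy vertices can be chosen greedily to avoid any
   bounded set, so if there are s heavy vertices then an edge missing all of them
   would extend to a matching of size s + 1; hence they cover H, which is the
   union of their stars.
   If there are at most s - 1 heavy vertices, let T, of bounded size, be the union
   of a maximal matching, so that T meets every edge, and count sunflowers by
   their core C. A core through a heavy vertex accounts for at most
   (s-1) n^(k-2)/(k-2)! * n^l/l! of them. A core disjoint from T has codegree at
   most |T|, and the cores through a given light vertex of T have total codegree
   O(n^(k-2)), so all the others contribute O(n^(k+l-3)). *)
Require Import Defs.
From mathcomp Require Import all_boot all_order all_algebra.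
From mathcomp Require Import reals.

Import Order.TTheory GRing.Theory Num.Theory.

(** * Elementary counting bounds *)

Lemma bin_fact_le_exp (n m : nat) : ('C(n, m) * m`! <= n ^ m)%N.
Proof.
rewrite bin_ffact; elim: m => [|m IHm]; first by rewrite ffactn0.
by rewrite ffactnSr expnSr leq_mul // leq_subr.
Qed.

Lemma bin_le_exp (n m : nat) : ('C(n, m) <= n ^ m)%N.
Proof. by apply: leq_trans (bin_fact_le_exp n m); rewrite leq_pmulr ?fact_gt0. Qed.

Lemma leq_card_sum (I J : finType) (P : pred I) (A : {set J}) (B : I -> {set J}) :
  A \subset \bigcup_(i | P i) B i -> (#|A| <= \sum_(i | P i) #|B i|)%N.
Proof.
move/subset_leq_card/leq_trans; apply.
elim/big_rec2: _ => [|i u v _ IH]; first by rewrite cards0.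
by apply: leq_trans (leq_card_setU _ _) _; rewrite leq_add2l.
Qed.

Section Families.

Context {V : finType}.
Implicit Types (x y : V) (A C S T U X : {set V}) (F H : {set {set V}}).

(** * Links and codegrees *)

(** Members keep [C], unlike in the usual link; the cardinality is the codegree of [C]. *)
Definition link_family H C := [set A in H | C \subset A].

Lemma card_supersets S (m : nat) :
  (#|[set A : {set V} | (#|A| == #|S| + m) && (S \subset A)]| <= 'C(#|V|, m))%N.
Proof.
rewrite -(card_draws V m).
rewrite -(card_in_imset (f := fun A => A :\: S)).
  apply/subset_leq_card/subsetP => _ /imsetP [A /[!inE] /andP[/eqP cA sSA] ->].
  by rewrite cardsD (setIidPr sSA) cA addKn.
move=> A B /[!inE] /andP[_ sA] /andP[_ sB] eqAB.
by rewrite -(setID A S) -(setID B S) (setIidPr sA) (setIidPr sB) eqAB.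
Qed.

(** Each member is [x |: C] for its single extra vertex [x], which the hypothesis places in [T]. *)
Lemma card_link_le {k H C T} :
    H \subset ksubsets V k.+1 -> #|C| = k ->
    (forall A, A \in link_family H C -> exists2 x, x \in A :&: T & x \notin C) ->
  (#|link_family H C| <= #|T|)%N.
Proof.
move=> /subsetP HK cC out.
apply: leq_trans (leq_imset_card (fun x => x |: C) T).
apply/subset_leq_card/subsetP => A AH.
have [x /setIP[xA xT] xC] := out A AH.
move: AH; rewrite inE => /andP[/HK /[!inE] /eqP cA sCA].
apply/imsetP; exists x => //; apply/esym/eqP.
by rewrite eqEcard subUset sub1set xA sCA /= cardsU1 xC cC cA.
Qed.

Lemma card_link_max k H C :
  H \subset ksubsets V k.+1 -> #|C| = k -> (#|link_family H C| <= #|V|)%N.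
Proof.
move=> HK cC; rewrite -cardsT; apply: (card_link_le HK cC) => A.
rewrite inE => /andP[/(subsetP HK) /[!inE] /eqP cA sCA].
have /subsetPn[x xA xC] : ~~ (A \subset C).
  by apply/negP => /subset_leq_card; rewrite cA cC ltnn.
by exists x => //; rewrite !inE xA.
Qed.

(** Such an edge contains a pair [[set x; u]] with [u] in [U], and each pair has codegree at most
    [#|V| ^ k]. *)
Lemma card_edges_meeting {k H x U} :
    H \subset ksubsets V k.+2 -> x \notin U ->
  (#|[set A in link_family H [set x] | ~~ [disjoint A & U]]| <=
     #|U| * #|V| ^ k)%N.
Proof.
move=> /subsetP HK xU; rewrite -sum_nat_const.
pose B u := [set A : {set V} | (#|A| == #|[set x; u]| + k) && ([set x; u] \subset A)].
apply: (@leq_trans (\sum_(u in U) #|B u|)).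
  apply: leq_card_sum; apply/subsetP => A.
  rewrite !inE => /andP[/andP[/HK /[!inE] /eqP cA xA]] /pred0Pn[u /= /andP[uA uU]].
  have xu : x != u by apply: contraNneq xU => ->.
  apply/bigcupP; exists u => //; rewrite !inE subUset xA sub1set uA.
  by rewrite cards2 xu cA eqxx.
by apply: leq_sum => u _; apply: leq_trans (card_supersets _ _) (bin_le_exp _ _).
Qed.

(** * Matchings, covers and heavy vertices *)

Lemma matching_le {s H F} :
  (matching_number H <= s)%N -> F \subset H -> trivIset F -> (#|F| <= s)%N.
Proof.
move=> nuH FH tF; apply: leq_trans nuH.
by rewrite /matching_number (leq_bigmax_cond (F := fun F => #|F|)) // FH.
Qed.

(** Nonemptiness matters for the size: the empty set is disjoint from [cover F] even when it belongs
    to [F]. *)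
Lemma matchingU1 {A F} :
    trivIset F -> A != set0 -> [disjoint A & cover F] ->
  trivIset (A |: F) /\ #|A |: F| = #|F|.+1.
Proof.
move=> tF A0 dA.
split.
  apply: trivIsetU => //; last by rewrite /cover big_set1.
  by apply/trivIsetP => B C /set1P -> /set1P ->; rewrite eqxx.
have nAF : A \notin F.
  apply: contra A0 => AF; rewrite -setI_eq0 in dA.
  by rewrite -subset0 -(eqP dA) subsetI subxx; apply: (bigcup_sup A).
by rewrite cardsU1 nAF.
Qed.

Lemma card_cover_le {k H F} :
  H \subset ksubsets V k -> F \subset H -> (#|cover F| <= #|F| * k)%N.
Proof.
move=> /subsetP HK /subsetP FH; apply: leq_trans (leq_card_cover F) _.
rewrite -sum_nat_const; apply: leq_sum => A /FH/HK.
by rewrite inE => /eqP ->.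
Qed.

Lemma exists_cover_of_matching {k s H} :
    H \subset ksubsets V k.+1 -> (matching_number H <= s)%N ->
  exists2 T : {set V}, (#|T| <= s * k.+1)%N &
    forall A, A \in H -> ~~ [disjoint A & T].
Proof.
move=> HK nuH; pose P F := (F \subset H) && trivIset F.
have [|F /maxsetP[/andP[FH tF] maxF]] := @ex_maxset _ P.
  by exists set0; rewrite /P sub0set; apply/trivIsetP => A B; rewrite inE.
exists (cover F) => [|A AH].
  apply: leq_trans (card_cover_le HK FH) _.
  by rewrite leq_mul2r (matching_le nuH FH tF) orbT.
apply/negP => dA.
have A0 : A != set0.
  by have := subsetP HK _ AH; rewrite inE -card_gt0 => /eqP ->.
have [tAF cAF] := matchingU1 tF A0 dA.
have := maxF (A |: F); rewrite /P tAF subUset sub1set AH FH subsetUr => /(_ isT isT).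
by move=> eqF; move: cAF; rewrite eqF => /n_Sn.
Qed.

(* [k] is the uniformity minus 2. The threshold makes a heavy vertex have an
   edge avoiding any [s.+1 * k.+2] other vertices, as two vertices lie in at most
   [#|V| ^ k] common edges. *)
Definition heavy (s k : nat) H : {set V} :=
  [set x | s.+1 * k.+2 * #|V| ^ k < #|link_family H [set x]|]%N.

Lemma heavy_edge {s k H x U} :
    H \subset ksubsets V k.+2 -> x \in heavy s k H -> x \notin U ->
    (#|U| <= s.+1 * k.+2)%N ->
  exists A, [/\ A \in H, x \in A & [disjoint A & U]].
Proof.
move=> HK; rewrite inE => hx xU cU.
set M := [set A in link_family H [set x] | ~~ [disjoint A & U]].
have /subsetPn[A] : ~~ (link_family H [set x] \subset M).
  apply: contraL hx => /subset_leq_card le_M; rewrite -leqNgt.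
  apply: leq_trans le_M (leq_trans (card_edges_meeting HK xU) _).
  by rewrite leq_mul2r cU orbT.
rewrite !inE => /[dup] /andP[AH]; rewrite sub1set => xA -> /=; rewrite negbK => dA.
by exists A.
Qed.

(** Greedy extension: each new edge avoids the current matching and also the heavy vertices still to
    be used, which therefore stay available. *)
Lemma heavy_matching {s k H} (HK : H \subset ksubsets V k.+2) :
  forall (m : nat) X F, #|X| = m -> X \subset heavy s k H ->
    F \subset H -> trivIset F -> [disjoint X & cover F] ->
    (#|F| + m <= s.+1)%N ->
  exists F', [/\ F' \subset H, trivIset F' & #|F'| = #|F| + m]%N.
Proof.
elim=> [|m IHm] X F cX XH FH tF dXF le_s; first by exists F; rewrite addn0.
have /set0Pn[x xX] : X != set0 by rewrite -card_gt0 cX.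
have cXx : #|X :\ x| = m by move: (cardsD1 x X); rewrite xX cX => -[].
have xU : x \notin cover F :|: X :\ x.
  by rewrite !inE eqxx orbF (disjointFr dXF xX).
have [|A [AH xA dA]] := heavy_edge HK (subsetP XH x xX) xU.
  (* The avoided set has at most [#|F| * k.+2 + m] vertices, within the reach of [heavy_edge] since
     [#|F| + m.+1 <= s.+1]. *)
  apply: leq_trans (leq_card_setU _ _) _; rewrite cXx.
  apply: (@leq_trans ((#|F| + m.+1) * k.+2)); last by rewrite leq_mul2r le_s orbT.
  rewrite mulnDl leq_add ?(card_cover_le HK FH) //.
  by apply: leq_trans (leqnSn m) _; rewrite leq_pmulr.
have A0 : A != set0 by apply/set0Pn; exists x.
have dAF := disjointWr (subsetUl _ _) dA.
have dAX := disjointWr (subsetUr _ _) dA.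
have [tAF cAF] := matchingU1 tF A0 dAF.
have [|||||F' [F'H tF' cF']] := IHm (X :\ x) (A |: F) cXx.
- by apply: subset_trans XH; apply: subD1set.
- by rewrite subUset sub1set AH.
- by [].
- rewrite /cover bigcup_setU big_set1 -/(cover F) -setI_eq0 setIUr setU_eq0 !setI_eq0.
  rewrite disjoint_sym dAX /=; exact: disjointWl (subD1set _ _) dXF.
- by rewrite cAF addSnnS.
by exists F'; split=> //; rewrite cF' cAF addSnnS.
Qed.

(** An edge missing [X] could start the greedy extension, giving a matching of size [s.+1]. *)
Lemma heavy_cover {s k H X} :
    H \subset ksubsets V k.+2 -> (matching_number H <= s)%N ->
    X \subset heavy s k H -> #|X| = s ->
  forall A, A \in H -> ~~ [disjoint A & X].
Proof.
move=> HK nuH XH cX A AH; apply/negP => dAX.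
have cov1 : cover [set A] = A by rewrite /cover big_set1.
have [||||F [FH tF cF]] := heavy_matching HK s X [set A] cX XH.
- by rewrite sub1set.
- by apply/trivIsetP => B C /set1P -> /set1P ->; rewrite eqxx.
- by rewrite cov1 disjoint_sym.
- by rewrite cards1.
by have := matching_le nuH FH tF; rewrite cF cards1 add1n ltnn.
Qed.

Lemma union_of_stars {s H X} :
    #|X| = s -> (forall A, A \in H -> ~~ [disjoint A & X]) ->
  union_of_trivial_intersecting s H.
Proof.
move=> cX covX.
pose x (i : 'I_s) := enum_val (cast_ord (esym cX) i).
pose G i := [set A in H | x i \in A].
have xG i : x i \in \bigcap_(A in G i) A.
  by apply/bigcapP => A; rewrite inE => /andP[].
exists G, x; split=> //.
- by move=> i j /enum_val_inj /cast_ord_inj.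
- move=> i; split; last by apply/set0Pn; exists (x i).
  move=> A B /[!inE] /andP[_ xA] /andP[_ xB].
  by apply/set0Pn; exists (x i); rewrite inE xA.
apply/setP => A; apply/idP/bigcupP => [AH|[i _]]; last by rewrite inE => /andP[].
have /pred0Pn[y /= /andP[yA yX]] := covX A AH.
exists (cast_ord cX (enum_rank_in yX y)) => //.
by rewrite inE AH /x cast_ordK enum_rankK_in.
Qed.

(** * Counting sunflowers by core *)

Lemma num_sunflowers_le (k l c : nat) H :
  (num_sunflowers k l c H <= \sum_(C : {set V} | #|C| == c) 'C(#|link_family H C|, l))%N.
Proof.
rewrite [leqRHS](eq_bigr (fun C => #|[set F : {set {set V}} | F \subset link_family H C & #|F| == l]|)).
  apply: leq_card_sum; apply/subsetP => F; rewrite inE => /andP[FH].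
  move=> /existsP[C /andP[cC /and4P[_ cF /forall_inP sC _]]].
  apply/bigcupP; exists C => //; rewrite inE cF andbT.
  by apply/subsetP => A AF; rewrite inE (subsetP FH) // sC.
by move=> C _; rewrite cards_draws.
Qed.

(** Double counting of pairs [C \subset A]: an edge through [y] has only [k.+1] subsets of size
    [k]. *)
Lemma sum_link_star k H y :
    H \subset ksubsets V k.+1 ->
  (\sum_(C : {set V} | (#|C| == k) && (y \in C)) #|link_family H C| <=
     k.+1 * #|link_family H [set y]|)%N.
Proof.
move=> /subsetP HK.
under eq_bigr => C _ do rewrite -sum1_card big_mkcond /=.
rewrite exchange_big /= mulnC -sum_nat_const big_mkcond [leqRHS]big_mkcond /=.
rewrite leq_sum // => A _.
case: (boolP (A \in link_family H [set y])) => [|nA]; last first.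
  rewrite big1 // => C /andP[_ yC]; case: ifP => //.
  rewrite inE => /andP[AH sCA]; case/negP: nA.
  by rewrite inE AH sub1set (subsetP sCA).
rewrite inE => /andP[/HK /[!inE] /eqP cA _].
rewrite -big_mkcondr sum1_card -[k.+1 in leqRHS]bin1 -bin_sub // subn1 /= -cA -cards_draws.
apply/subset_leq_card/subsetP => C; rewrite !inE unfold_in /= => /andP[/andP[-> _]].
by rewrite inE => /andP[_ ->].
Qed.

(** Here [k] and [l] are the uniformity and the number of petals, each minus 2. Multiplying by the
    factorials keeps the leading coefficient an integer. *)
Lemma few_heavy_sunflowers {s k l H} :
    H \subset ksubsets V k.+2 -> (matching_number H <= s)%N ->
    (0 < #|V|)%N -> (#|heavy s k H| < s)%N ->
  (num_sunflowers k.+2 l.+2 k.+1 H * (k`! * l.+2`!) <=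
    s.-1 * #|V| ^ (k + l.+2) +
    ((s * k.+2) ^ l.+2 + s * k.+2 * (k.+2 * (s.+1 * k.+2))) * (k`! * l.+2`!) *
      #|V| ^ (k + l.+1))%N.
Proof.
move=> HK nuH V_gt0 few; set X := heavy s k H in few *; set n := #|V| in V_gt0 *.
have [T cT covT] := exists_cover_of_matching HK nuH.
pose d C := #|link_family H C|.
have d_max C : #|C| == k.+1 -> (d C <= n)%N.
  by move/eqP=> cC; apply: card_link_max HK cC.
pose star y := (\sum_(C : {set V} | (#|C| == k.+1) && (y \in C)) 'C(d C, l.+2))%N.
(* At most ['C(n, k)] cores contain [y], each with at most ['C(n, l.+2)] sunflowers; the factorials
   cancel exactly. *)
have star_heavy y : (star y * (k`! * l.+2`!) <= n ^ (k + l.+2))%N.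
  apply: (@leq_trans ('C(n, k) * 'C(n, l.+2) * (k`! * l.+2`!))).
    rewrite leq_mul2r; apply/orP; right.
    apply: (@leq_trans (\sum_(C : {set V} | (#|C| == k.+1) && (y \in C)) 'C(n, l.+2))).
      by apply: leq_sum => C /andP[cC _]; apply: leq_bin2l; apply: d_max.
    rewrite sum_nat_const leq_mul2r; apply/orP; right.
    have := card_supersets [set y] k; rewrite cards1; apply: leq_trans.
    by apply/subset_leq_card/subsetP => C; rewrite !inE unfold_in sub1set.
  by rewrite mulnACA expnD leq_mul // bin_fact_le_exp.
(* Bounding all but one factor of [d C ^ l.+2] by [n] leaves the total codegree, which
   [sum_link_star] ties to the small degree of [y]. *)
have star_light y : y \notin X -> (star y <= k.+2 * (s.+1 * k.+2) * n ^ (k + l.+1))%N.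
  rewrite inE -leqNgt => ly.
  apply: (@leq_trans (\sum_(C : {set V} | (#|C| == k.+1) && (y \in C)) d C * n ^ l.+1)).
    apply: leq_sum => C /andP[cC _]; apply: leq_trans (bin_le_exp _ _) _.
    by rewrite expnS leq_mul2l leq_exp2r // d_max ?orbT.
  rewrite -big_distrl /= expnD mulnA leq_mul2r; apply/orP; right.
  apply: leq_trans (sum_link_star k.+1 H y HK) _.
  by rewrite -mulnA leq_mul2l ly orbT.
(* Every edge meets [T], so the extra vertex over a core missing [T] lies in [T]. *)
have away : (\sum_(C : {set V} | (#|C| == k.+1) && [disjoint C & T]) 'C(d C, l.+2) <=
              (s * k.+2) ^ l.+2 * n ^ (k + l.+1))%N.
  apply: (@leq_trans (\sum_(C : {set V} | (#|C| == k.+1) && [disjoint C & T])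
                        (s * k.+2) ^ l.+2)).
    apply: leq_sum => C /andP[/eqP cC dCT]; apply: leq_trans (bin_le_exp _ _) _.
    rewrite leq_exp2r //; apply: leq_trans cT; apply: (card_link_le HK cC) => A.
    rewrite inE => /andP[/covT/pred0Pn[t /= /andP[tA tT]] _].
    by exists t; rewrite ?inE ?tA // (disjointFl dCT tT).
  rewrite sum_nat_const mulnC leq_mul2l; apply/orP; right.
  apply: (@leq_trans (n ^ k.+1)); last by rewrite leq_pexp2l // -addn1 leq_add2l.
  apply: leq_trans (bin_le_exp _ _); rewrite -card_draws.
  by apply/subset_leq_card/subsetP => C; rewrite !inE unfold_in => /andP[].
have split_sum : (num_sunflowers k.+2 l.+2 k.+1 H <=
   \sum_(y in X) star y +
   (\sum_(C : {set V} | (#|C| == k.+1) && [disjoint C & T]) 'C(d C, l.+2) +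
   \sum_(y in T | y \notin X) star y))%N.
  apply: leq_trans (num_sunflowers_le _ _ _ _) _.
  have starE (P : pred V) : (\sum_(y | P y) star y =
      \sum_(C : {set V} | #|C| == k.+1) \sum_(y | P y && (y \in C)) 'C(d C, l.+2))%N.
    rewrite (exchange_big_dep (fun C : {set V} => #|C| == k.+1)) /=; last first.
      by move=> y C _ /andP[].
    by apply: eq_bigr => C ->.
  rewrite !starE big_mkcondr -!big_split /=; apply: leq_sum => C cC.
  (* Each core is charged at least once: it misses [T], or contains some [t] in [T] that is either
     heavy or light. *)
  case: ifP => [_|]; first by rewrite -/(d C) addnCA leq_addr.
  move=> /negbT/pred0Pn[t /= /andP[tC tT]].
  have [tX|tX] := boolP (t \in X).
    by rewrite (bigD1 t) /= ?tX // -!addnA leq_addr.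
  by rewrite addnC [X in (X + _)%N](bigD1 t) /= ?tT ?tX // -!addnA leq_addr.
apply: leq_trans (leq_mul split_sum (leqnn _)) _; rewrite mulnDl leq_add //.
  rewrite big_distrl /=.
  apply: (@leq_trans (\sum_(y in X) n ^ (k + l.+2))); first by apply: leq_sum.
  by rewrite sum_nat_const leq_mul2r -ltnS (ltn_predK few) few orbT.
rewrite [leqRHS]mulnAC leq_mul2r; apply/orP; right.
rewrite mulnDl leq_add //.
apply: (@leq_trans (\sum_(y in T) k.+2 * (s.+1 * k.+2) * n ^ (k + l.+1))).
  by rewrite big_mkcondr; apply: leq_sum => y _; case: ifP => // /star_light.
by rewrite sum_nat_const mulnA !leq_mul2r cT !orbT.
Qed.

End Families.

Local Open Scope ring_scope.

(** * Conclusion for large [n] *)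

Theorem theorem2p1 (R : realType) (k s l : nat)
    (hs : (1 <= s)%N) (hk : (2 <= k)%N) (hl : (2 <= l)%N)
    (eps : R) (heps : 0 < eps) :
  exists n_eps : nat, forall n : nat, (n_eps <= n)%N ->
    forall H : {set {set 'I_n}},
      H \subset ksubsets 'I_n k ->
      (matching_number H <= s)%N ->
      ((s%:R - 1) / ((k - 2)`!%:R * l`!%:R) + eps) * n%:R ^+ (k + l - 2)
        <= (num_sunflowers k l (k - 1) H)%:R ->
      union_of_trivial_intersecting s H.
Proof.
case: k hk => [|[|k]] // _; case: l hl => [|[|l]] // _.
have -> : (k.+2 + l.+2 - 2 = k + l.+2)%N by rewrite !addSn subn2.
rewrite (subn2 k.+2) subn1 /=.
pose D := (k`! * l.+2`!)%N.
pose K := (((s * k.+2) ^ l.+2 + s * k.+2 * (k.+2 * (s.+1 * k.+2))) * D)%N.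
(* Beyond [K / eps] the error [K * n ^ (k + l.+1)] is smaller than [eps * n ^ (k + l.+2)]; the
   successor also makes [n] positive. *)
exists (Num.bound (K%:R / eps)).+1 => n le_n H HK nuH.
have n_gt0 : (0 < n)%N by apply: leq_ltn_trans le_n.
have D_gt0 : (0 < D)%N by rewrite muln_gt0 !fact_gt0.
have [few|many] := ltnP #|heavy s k H| s; last first.
  have [X XH cX] : exists2 X : {set 'I_n}, X \subset heavy s k H & #|X| = s.
    exists [set x in take s (enum (heavy s k H))].
      by apply/subsetP => x; rewrite inE => /mem_take; rewrite mem_enum.
    rewrite cardsE (card_uniqP (take_uniq _ (enum_uniq _))) size_take_min -cardE.
    exact/minn_idPl.
  by move=> _; apply: (union_of_stars cX (heavy_cover HK nuH XH cX)).
have := few_heavy_sunflowers (l := l) HK nuH; rewrite card_ord => /(_ n_gt0 few).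
set N := num_sunflowers _ _ _ _; rewrite -/D -/K => leN geN; exfalso.
move: leN; rewrite -(ler_nat R) !natrD (natrM _ N) (natrM _ s.-1) (natrM _ K) !natrX => leN.
have D_gt0' : 0 < D%:R :> R by rewrite ltr0n.
have s1 : s.-1%:R = s%:R - 1 :> R by rewrite -subn1 natrB.
(* Scaling the lower bound by [D] makes the leading terms cancel, leaving [eps * D * n <= K], which
   contradicts the choice of [n] because [D >= 1]. *)
have := le_trans (ler_wpM2r (ltW D_gt0') geN) leN.
rewrite s1 -natrM -/D mulrAC mulrDl divfK ?gt_eqF // mulrDl lerD2l.
rewrite addnS exprS mulrA ler_pM2r ?exprn_gt0 ?ltr0n // leNgt => /negP; apply.
have le_epsD : eps <= eps * D%:R by rewrite ler_peMr ?ler1n // ltW.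
apply: lt_le_trans (ler_wpM2r (ler0n _ _) le_epsD).
rewrite mulrC -ltr_pdivrMr //.
apply: lt_le_trans (archi_boundP _) _; first by rewrite divr_ge0 ?ler0n ?(ltW heps).
by rewrite ler_nat ltnW.
Qed.
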